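(* (i) Let $I$ be a compact interval and let $f:I\to I$ be a continuous map such that $(I,f)$ has a periodic point of odd period different from $1$. Then $(I,f)$ is transitive if and only if $(\mathcal{M}(I),\hat f)$ is transitive. (ii) There exist a compact interval $I$ and a continuous map $f:I\to I$ such that: (1) $(I,f)$ has no periodic points of odd period different from $1$; and (2) $(I,f)$ is transitive but $(\mathcal{M}(I),\hat f)$ is not transitive.
   Context: For a compact metric space $(X,d)$ and a continuous map $f:X\to X$, $(X,f)$ denotes the corresponding (autonomous) dynamical system. $\mathcal{M}(X)$ is the space of all Borel probability measures on $X$ with the Prohorov metric $\mathcal{P}_d(\mu,\nu)=\inf\{\epsilon>0:\mu(A)\le\nu(A^\epsilon)+\epsilon \text{ and } \nu(A)\le\mu(A^\epsilon)+\epsilon \text{ for all Borel } A\subset X\}$, where $A^\epsilon=\{x\in X: d(x,A)<\epsilon\}$; its topology is the weak$^*$-topology and $\mathcal{M}(X)$ is a compact metric space. The induced continuous map $\hat f:\mathcal{M}(X)\to\mathcal{M}(X)$ is $\hat f(\mu)(A)=\mu(f^{-1}(A))$ for $A$ Borel. A system $(X,f)$ is transitive if for any two nonempty open sets $U,V\subset X$ there is $n\ge1$ with $f^n(U)\cap V\ne\emptyset$. The period of a periodic point is its least period. *)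

(* Defs.v *)
From HB Require Import structures.
From mathcomp Require Import all_boot all_order all_algebra.
From mathcomp Require Import all_classical all_reals all_analysis.

Set Implicit Arguments.
Unset Strict Implicit.
Unset Printing Implicit Defensive.

Import Order.TTheory GRing.Theory Num.Theory.
Import numFieldNormedType.Exports.

Local Open Scope classical_set_scope.
Local Open Scope ring_scope.

Definition topologically_transitive (T : topologicalType) (f : T -> T) : Prop :=
  forall U V : set T, open U -> open V -> U !=set0 -> V !=set0 ->
    exists2 n : nat, (1 <= n)%N & ((iter n f @` U) `&` V) !=set0.

Definition has_least_period (T : Type) (f : T -> T) (x : T) (n : nat) : Prop :=
  [/\ (0 < n)%N, iter n f x = x
    & forall m : nat, (0 < m < n)%N -> iter m f x <> x].

(* The library's measurable types are pointed, hence so are the metric spaces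
   on which Borel measures are considered. *)
#[short(type="pmetricType")]
HB.structure Definition PointedMetric (R : numDomainType) :=
  {T of Pointed T & Metric R T}.

Section borel_probability.
Variables (R : realType) (X : pmetricType R).

Definition borel : measurableType (@open X).-sigma :=
  g_sigma_algebraType (@open X).

Definition set_dist (x : X) (A : set X) : \bar R :=
  ereal_inf [set (mdist x y)%:E | y in A].

Definition enlarge (A : set X) (e : R) : set X :=
  [set x | (set_dist x A < e%:E)%E].

(* A [probability] also assigns (irrelevant) values to the nonmeasurable sets.
   The distance below only sees measurable ones, so it makes this type a
   pseudometric space, in which two measures are at distance 0 iff they agree
   on all Borel sets. *)
Definition borel_probability : Type := probability borel R.

HB.instance Definition _ := Choice.on borel_probability.
HB.instance Definition _ := Pointed.on borel_probability.

Implicit Types mu nu : borel_probability.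

Definition prohorov_bounds mu nu : set R := [set e | 0 < e /\
  forall A : set borel, measurable A ->
    (mu A <= nu (enlarge A e) + e%:E)%E /\
    (nu A <= mu (enlarge A e) + e%:E)%E].

Definition prohorov mu nu : R := inf (prohorov_bounds mu nu).

Lemma enlargeP (A : set X) (e : R) (x : X) :
  enlarge A e x <-> exists2 y, A y & mdist x y < e.
Proof.
split=> [/ereal_inf_lt[_ /= [y Ay <-]]|[y Ay xye]].
  by rewrite lte_fin => ?; exists y.
rewrite /enlarge /= /set_dist; apply: (@le_lt_trans _ _ (mdist x y)%:E).
  by apply: ereal_inf_lbound; exists y.
by rewrite lte_fin.
Qed.

Lemma sub_enlarge (A : set X) (e : R) : 0 < e -> A `<=` enlarge A e.
Proof. by move=> e0 x Ax; apply/enlargeP; exists x => //; rewrite mdistxx. Qed.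

Lemma open_enlarge (A : set X) (e : R) : open (enlarge A e).
Proof.
have -> : enlarge A e = \bigcup_(y in A) ball y e.
  apply/seteqP; split=> [x /enlargeP[y Ay xy]|x [y Ay]].
    by exists y => //; rewrite ballEmdist /= metric_sym.
  by rewrite ballEmdist /= metric_sym => xy; apply/enlargeP; exists y.
apply: bigcup_open => y _; rewrite openE => x; rewrite ballEmdist /= => yx.
apply/nbhs_ballP; exists (e - mdist y x) => /=; first by rewrite subr_gt0.
move=> z; rewrite !ballEmdist /= ltrBrDl.
exact: le_lt_trans (metric_triangle _ _ _).
Qed.

Lemma measurable_enlarge (A : set X) (e : R) :
  measurable (enlarge A e : set borel).
Proof. exact: sub_gen_smallest (open_enlarge A e). Qed.

Lemma enlarge_comp (A : set X) (e1 e2 : R) :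
  enlarge (enlarge A e1) e2 `<=` enlarge A (e1 + e2).
Proof.
move=> x /enlargeP[y /enlargeP[z Az yz] xy]; apply/enlargeP; exists z => //.
by rewrite addrC (le_lt_trans (metric_triangle _ y _))// ltrD.
Qed.

Lemma prohorov_bounds1 mu nu : prohorov_bounds mu nu 1.
Proof.
split=> // A mA; split; (apply: le_trans (probability_le1 _ mA) _);
  by rewrite leeDr.
Qed.

Lemma prohorov_bounds_inf mu nu : has_inf (prohorov_bounds mu nu).
Proof.
split; first by exists 1; exact: prohorov_bounds1.
by exists 0 => e [/ltW].
Qed.

Lemma prohorov_boundsC mu nu : prohorov_bounds mu nu = prohorov_bounds nu mu.
Proof.
by apply/seteqP; split=> e [e0 H]; split=> // A /H[].
Qed.

Lemma prohorovxx mu : prohorov mu mu = 0.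
Proof.
have bnd e : 0 < e -> prohorov_bounds mu mu e.
  move=> e0; split=> // A mA; suff : (mu A <= mu (enlarge A e) + e%:E)%E by [].
  apply: (@le_trans _ _ (mu (enlarge A e))).
    apply: le_measure; rewrite ?inE//; first exact: measurable_enlarge.
    exact: sub_enlarge.
  by rewrite leeDl// lee_fin ltW.
apply/eqP; rewrite eq_le; apply/andP; split.
  apply/ler_addgt0Pl => e e0; rewrite addr0; apply: ge_inf (bnd e e0).
  by case: (prohorov_bounds_inf mu mu).
by apply: lb_le_inf => [|e [/ltW]//]; exists 1; exact: prohorov_bounds1.
Qed.

Lemma prohorov_sym mu nu : prohorov mu nu = prohorov nu mu.
Proof. by rewrite /prohorov prohorov_boundsC. Qed.

Lemma prohorov_bounds_comp mu nu la e1 e2 :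
  prohorov_bounds mu nu e1 -> prohorov_bounds nu la e2 ->
  forall A : set borel, measurable A ->
    (mu A <= la (enlarge A (e1 + e2)) + (e1 + e2)%:E)%E.
Proof.
move=> [_ H1] [_ H2] A mA; have [h1 _] := H1 _ mA.
have [h2 _] := H2 _ (measurable_enlarge A e1).
apply: (le_trans h1); rewrite EFinD (addeC e1%:E) addeA leeD2r//.
apply: (le_trans h2); rewrite leeD2r//.
apply: le_measure; rewrite ?inE//; [exact: measurable_enlarge..|].
exact: enlarge_comp.
Qed.

Lemma prohorov_triangle nu mu la : prohorov mu la <= prohorov mu nu + prohorov nu la.
Proof.
apply/ler_addgt0Pl => e e0; rewrite addrC.
have e20 : 0 < e / 2 by rewrite divr_gt0.
have [e1 b1 lt1] := inf_adherent e20 (prohorov_bounds_inf mu nu).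
have [e2 b2 lt2] := inf_adherent e20 (prohorov_bounds_inf nu la).
apply: (@le_trans _ _ (e1 + e2)); last first.
  by rewrite [e]splitr addrACA lerD// ltW.
apply: ge_inf; first by case: (prohorov_bounds_inf mu la).
split; first by rewrite addr_gt0//; [case: b1|case: b2].
move=> A mA; split; first exact: (prohorov_bounds_comp b1 b2).
move: b1 b2; rewrite (prohorov_boundsC mu nu) (prohorov_boundsC nu la) => b1 b2.
by rewrite (addrC e1); exact: (prohorov_bounds_comp b2 b1).
Qed.

Let pball mu (e : R) : set borel_probability := [set nu | prohorov mu nu < e].

Let pent : set_system (borel_probability * borel_probability) :=
  entourage_ pball.

Let pnbhs mu : set_system borel_probability := nbhs_ pent mu.

Let pnbhsE : pnbhs = nbhs_ pent. Proof. by []. Qed.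

HB.instance Definition _ := hasNbhs.Build borel_probability pnbhs.

Let pball_center mu (e : R) : 0 < e -> pball mu e mu.
Proof. by move=> e0; rewrite /pball /= prohorovxx. Qed.

Let pball_sym mu nu (e : R) : pball mu e nu -> pball nu e mu.
Proof. by rewrite /pball /= prohorov_sym. Qed.

Let pball_triangle mu nu la (e1 e2 : R) :
  pball mu e1 nu -> pball nu e2 la -> pball mu (e1 + e2) la.
Proof.
rewrite /pball /= => ? ?.
by rewrite (le_lt_trans (prohorov_triangle nu mu la))// ltrD.
Qed.

Let pentE : pent = entourage_ pball. Proof. by []. Qed.

HB.instance Definition _ := @Nbhs_isPseudoMetric.Build R borel_probability
  pent pnbhsE pball pball_center pball_sym pball_triangle pentE.

Lemma ball_prohorovE mu (e : R) : ball mu e = [set nu | prohorov mu nu < e].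
Proof. by []. Qed.

End borel_probability.

Lemma continuous_borel_measurable (R : realType) (X : pmetricType R)
  (f : X -> X) :
  continuous f -> measurable_fun [set: borel X] (f : borel X -> borel X).
Proof.
move=> cf; apply: (measurability (@open X : set (set (borel X)))) => [//|_] [B oB <-]; rewrite setTI.
by apply: sub_gen_smallest; move/continuousP: cf; exact.
Qed.

Section induced_map.
Variables (R : realType) (X : pmetricType R) (f : X -> X).
Hypothesis cf : continuous f.
Variable mu : borel_probability X.

Let mf : measurable_fun [set: borel X] (f : borel X -> borel X) :=
  continuous_borel_measurable cf.

Let image_measure : set (borel X) -> \bar R :=
  pushforward (mu : probability (borel X) R) (f : borel X -> borel X).

Let image_measure0 : image_measure set0 = 0%E. Proof. exact: measure0. Qed.

Let image_measure_ge0 A : (0 <= image_measure A)%E.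
Proof. exact: measure_ge0. Qed.

Let image_measure_sigma_additive : semi_sigma_additive image_measure.
Proof. exact: measure_semi_sigma_additive. Qed.

HB.instance Definition _ := isMeasure.Build _ _ _ image_measure
  image_measure0 image_measure_ge0 image_measure_sigma_additive.

Let image_measure_setT : image_measure [set: borel X] = 1%E.
Proof.
by rewrite /image_measure /pushforward preimage_setT probability_setT.
Qed.

HB.instance Definition _ :=
  Measure_isProbability.Build _ _ _ image_measure image_measure_setT.

Definition induced_map : borel_probability X :=
  (image_measure : probability (borel X) R).

Lemma induced_mapE (A : set (borel X)) : induced_map A = mu (f @^-1` A).
Proof. by []. Qed.

End induced_map.

Section compact_interval.
Variables (R : realType) (a b : R).

(* The proof that [a <= b] is a parameter because it provides the point
   required by [pmetricType]. *)
Definition compact_itv (_ : a <= b) : Type := set_type `[a, b].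

Variable ab : a <= b.
Local Notation I := (compact_itv ab).

HB.instance Definition _ := PseudoMetric.copy I (set_type `[a, b]).

Let left_endpoint : a \in `[a, b]%classic.
Proof. by rewrite inE /= in_itv /= lexx ab. Qed.

HB.instance Definition _ :=
  isPointed.Build I (exist _ a left_endpoint : set_type `[a, b]).

Let dist (x y : I) : R := `|set_val x - set_val y|.

Let dist_ge0 (x y : I) : 0 <= dist x y. Proof. exact: normr_ge0. Qed.

Let dist_positivity (x y : I) : dist x y = 0 -> x = y.
Proof.
by move=> /eqP; rewrite /dist normr_eq0 subr_eq0 => /eqP; exact: val_inj.
Qed.

Let ballEdist (x : I) (e : R) : ball x e = [set y | dist x y < e].
Proof. by []. Qed.

HB.instance Definition _ :=
  PseudoMetric_isMetric.Build R I dist_ge0 dist_positivity ballEdist.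

Lemma compact_itv_compact : compact [set: I].
Proof.
move=> F FF _; have Fab : (set_val @ F) `[a, b]%classic.
  by apply: (@filterS _ F _ setT) (filterT) => x _; exact: set_valP.
have [p [abp clp]] := @segment_compact R a b (set_val @ F) (fmap_proper_filter _ _) Fab.
exists (exist _ p (mem_set abp) : set_type `[a, b]); split=> // A B FA.
move=> /nbhs_ballP[e /= e0 eB].
have [||_ [[x Ax <-] pxe]] := clp (set_val @` A) (ball p e).
- by apply: (@filterS _ F _ A) FA => x Ax; exists x.
- exact: nbhsx_ballx.
- by exists x; split=> //; exact: eB.
Qed.

End compact_interval.

(* Main.v *)
Require Import Defs.
From HB Require Import structures.
From mathcomp Require Import all_boot all_order all_algebra.
From mathcomp Require Import all_classical all_reals all_analysis.
From mathcomp Require Import lra zify.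

(* An odd periodic orbit P makes a transitive interval map mixing. Fix an
   open interval J and k such that f^k(J) meets J; for each residue r the
   union of the f^(r+km)(J) is an interval, and the closures of these unions
   cover the space, so they all contain a given fixed point c. As |P| is odd, c
   does not split P evenly, and counting the points of P in each closure shows
   that all of them contain the point of the bigger side nearest to c, hence all
   of P. It follows that some iterate of J contains P. The images of the hull
   of P increase, and their union is dense by transitivity.

   A mixing map f of a compact metric space induces a transitive map: if mu and
   nu are given, cut the space into small pieces J_i and choose points z_ij near
   J_i with f^n(z_ij) near J_j. Then m = sum_ij mu(J_i) nu(J_j) delta_(z_ij) is
   close to mu, while its n-th image is close to nu.

   For the counterexample, take the map f of [-1, 1] which exchanges the two
   halves by x |-> -x on [-1, 0] and by the opposite of the tent map on [0, 1],
   so that f^2 is a tent map on each half. A measure carried by (0, 1] has each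
   of its iterates carried by one half, so it never comes close to
   (delta_1 + delta_(-1)) / 2. *)

Set Implicit Arguments.
Unset Strict Implicit.
Unset Printing Implicit Defensive.

Import Order.TTheory GRing.Theory Num.Theory.
Import numFieldNormedType.Exports.

Local Open Scope classical_set_scope.
Local Open Scope ring_scope.

(** * Mixing from an odd periodic orbit *)

(** [ordS] is injective, so the size of [S r] never drops as [r] grows, while advancing by [k] never
    raises it; hence all sizes agree. *)
Lemma card_shift_constant n k (S : nat -> {set 'I_n}) : (0 < k)%N ->
  (forall r i, i \in S r -> ordS i \in S r.+1) ->
  (forall r, S (r + k)%N \subset S r) ->
  forall r s, (#|S r| <= #|S s|)%N.
Proof.
move=> k0 Sshift Sk r s.
have mono u d : (#|S u| <= #|S (u + d)%N|)%N.
  elim: d => [|d IH]; first by rewrite addn0.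
  apply: leq_trans IH _; rewrite addnS -(card_imset _ (@ordS_inj n)).
  apply/subset_leq_card/fintype.subsetP => _ /imsetP[i iS ->].
  exact: Sshift.
have anti d : (#|S (s + k * d)%N| <= #|S s|)%N.
  elim: d => [|d IH]; first by rewrite muln0 addn0.
  by apply: leq_trans IH; rewrite mulnSr addnA; apply/subset_leq_card/Sk.
apply: leq_trans (anti r); have -> : (s + k * r = r + (s + k * r - r))%N by nia.
exact: mono.
Qed.

Lemma iter_periodic_mod (T : Type) (f : T -> T) x n i :
  iter n f x = x -> iter (i %% n) f x = iter i f x.
Proof.
move=> fx; rewrite [in RHS](divn_eq i n) addnC iterD; congr (iter _ _ _).
by elim: (i %/ n)%N => // q IH; rewrite mulSn iterD -IH.
Qed.

Lemma continuous_iter (T : topologicalType) (f : T -> T) :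
  continuous f -> forall n, continuous (iter n f).
Proof.
move=> cf; elim=> [|n IH] x; first exact: cvg_id.
by apply: continuous_comp; [exact: IH|exact: cf].
Qed.

Section reals.
Variable R : realType.
Implicit Types (x y z : R) (W : set R).

Lemma closure_distP W x :
  closure W x <-> forall e, 0 < e -> exists2 w, W w & `|x - w| < e.
Proof.
split=> [clx e e0|H B /nbhs_ballP[e /= e0 eB]].
  by have [w [Ww xw]] := clx _ (nbhsx_ballx x e e0); exists w.
by have [w Ww xw] := H e e0; exists w; split => //; exact: eB.
Qed.

Lemma closure_between W x y z : is_interval W ->
  closure W x -> closure W y -> x < z < y -> W z.
Proof.
move=> iW /closure_distP Wx /closure_distP Wy /andP[xz zy].
have [|u Wu xu] := Wx (z - x); first by rewrite subr_gt0.
have [|v Wv yv] := Wy (y - z); first by rewrite subr_gt0.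
apply: (iW u v) => //; move: xu yv; rewrite !ltr_norml; lra.
Qed.

Lemma closure_is_interval W : is_interval W -> is_interval (closure W).
Proof.
move=> iW x y Wx Wy z; rewrite !le_eqVlt => /andP[/orP[/eqP <-//|xz]].
case/orP => [/eqP ->//|zy]; apply: subset_closure.
by apply: closure_between iW Wx Wy _; rewrite xz.
Qed.

(** The predicate [P] serves to forget which of the three points is the middle one. *)
Lemma between_distinct x y z : x != y -> y != z -> x != z ->
  forall P : R -> Prop, P x -> P y -> P z ->
  exists u v w, [/\ P u, P v, P w & u < v < w].
Proof.
move=> xy yz xz P Px Py Pz.
case: (ltgtP x y) xy => // xy _; case: (ltgtP y z) yz => // yz _;
  case: (ltgtP x z) xz => // xz _; try lra.
- by exists x, y, z; rewrite xy.
- by exists x, z, y; rewrite xz.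
- by exists z, x, y; rewrite xz.
- by exists y, x, z; rewrite xy.
- by exists y, z, x; rewrite yz.
- by exists z, y, x; rewrite xy yz.
Qed.

Variable F : R -> R.
Hypothesis cF : continuous F.

Lemma is_interval_iter n W : is_interval W -> is_interval (iter n F @` W).
Proof.
move=> /connected_intervalP cW; apply/connected_intervalP.
apply: connected_continuous_connected => //.
by apply: continuous_subspaceT; exact: continuous_iter.
Qed.

Lemma closure_image W W' x :
  (forall w, W w -> W' (F w)) -> closure W x -> closure W' (F x).
Proof.
move=> FW clx B /cF FB; have [w [Ww Bw]] := clx _ FB.
by exists (F w); split=> //; exact: FW.
Qed.

(** The index [r] is a natural number rather than a residue: the class of [r + k] is the union over
    [m >= 1] of the images forming the class of [r]. *)
Definition orbit_class (J : set R) (k r : nat) : set R :=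
  [set y | exists m, (iter (r + k * m) F @` J) y].

(** As the [k]-th image of [J] meets [J], successive images in the union share a point, and a chain
    of overlapping intervals is an interval. *)
Lemma orbit_class_interval J k r : is_interval J ->
  ((iter k F @` J) `&` J) !=set0 -> is_interval (orbit_class J k r).
Proof.
move=> iJ [_ [[w Jw <-] Jkw]].
have iK m : is_interval (iter (r + k * m) F @` J) by exact: is_interval_iter.
have link m : (iter (r + k * m) F @` J) (iter (r + k * m.+1) F w).
  by exists (iter k F w) => //; rewrite -iterD mulnSr addnA.
have link' m : (iter (r + k * m.+1) F @` J) (iter (r + k * m.+1) F w).
  by exists w.
(* Induction on the number [d] of links: [z] is either between [x] and the shared point [v], thus in
   the current image, or between [v] and [y], one link fewer. *)
have chain d m x y z : (iter (r + k * m) F @` J) x ->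
    (iter (r + k * (m + d)) F @` J) y ->
    x <= z <= y \/ y <= z <= x -> orbit_class J k r z.
  elim: d m x => [|d IH] m x Kx Ky xyz.
    rewrite addn0 in Ky; exists m; case: xyz => xyz.
      exact: (iK m x y).
    exact: (iK m y x).
  have := link m; have := link' m; set v := iter _ _ _ => Kv' Kv.
  have [xzv|] : (x <= z <= v \/ v <= z <= x) \/ (v <= z <= y \/ y <= z <= v).
    by case: (leP z v); case: xyz => /andP[? ?] ?; lra.
  - by exists m; case: xzv; [exact: (iK m x v)|exact: (iK m v x)].
  - by apply: IH Kv' _; rewrite addSnnS.
move=> x y [m Kx] [m' Ky] z xzy.
have [mm|/ltnW mm] := leqP m m'.
  by apply: (chain (m' - m)%N m x y); rewrite ?subnKC//; left.
by apply: (chain (m - m')%N m' y x); rewrite ?subnKC//; right.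
Qed.

Variables a b : R.
Hypothesis Fab : forall x, a <= x <= b -> a <= F x <= b.

Definition orbit_dense (J : set R) := forall y, a <= y <= b ->
  forall e, 0 < e -> exists i, exists2 w, J w & `|y - iter i F w| < e.

(** Dividing the exponent by [k] puts every iterate into a class with [r < k], and closure commutes
    with finite unions. *)
Lemma orbit_class_cover J k y : (0 < k)%N -> orbit_dense J -> a <= y <= b ->
  exists r, closure (orbit_class J k r) y.
Proof.
move=> k0 Jd yab.
have cover K : closure (\big[setU/set0]_(r < K) orbit_class J k r) y ->
    exists r, closure (orbit_class J k r) y.
  elim: K => [|K IH]; first by rewrite big_ord0 closure0.
  by rewrite big_ord_recr closureU /= => -[/IH //|clK]; exists K.
apply: (cover k); apply/closure_distP => e e0.
have [i [w Jw yw]] := Jd y yab e e0.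
exists (iter i F w) => //; rewrite -bigcup_mkord.
exists (i %% k)%N; first by rewrite /= ltn_mod.
by exists (i %/ k)%N; exists w => //; rewrite addnC mulnC -divn_eq.
Qed.

Lemma fixed_point : a <= b -> exists2 c, a <= c <= b & F c = c.
Proof.
move=> ab; have [||c] := @IVT R (fun x => F x - x) a b 0 ab.
- apply: continuous_subspaceT => x; apply: cvgB; [exact: cF|exact: cvg_id].
- have := Fab (x := a); have := Fab (x := b); rewrite !lexx !ab.
  move=> /(_ isT)/andP[? ?] /(_ isT)/andP[? ?].
  by rewrite ge_min le_max; apply/andP; split; apply/orP; [right|left]; lra.
by rewrite in_itv /= => cab /eqP; rewrite subr_eq0 => /eqP; exists c.
Qed.

Section odd_orbit.
Variables (x0 : R) (n : nat).
Hypotheses (x0ab : a <= x0 <= b) (x0n : iter n F x0 = x0).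
Hypotheses (n_odd : odd n) (x0F : F x0 != x0).

Let p i := iter i F x0.

Let n_gt0 : (0 < n)%N. Proof. by case: n n_odd. Qed.

Let p_ab i : a <= p i <= b.
Proof. by elim: i => //= i; exact: Fab. Qed.

Let p_mod i : p (i %% n)%N = p i. Proof. exact: iter_periodic_mod. Qed.

Let pD i j : p (i + j)%N = iter i F (p j). Proof. exact: iterD. Qed.

(** The orbit would stay at a fixed point once there; since it returns to [x0], that point would be
    [x0]. *)
Let p_not_fixed i : F (p i) != p i.
Proof.
apply/eqP => Fpi; move/eqP: x0F; apply.
have fixed j : iter j F (p i) = p i by elim: j => //= j ->.
have x0E : x0 = p i.
  by rewrite -(fixed (n * i - i)%N) -pD subnK ?leq_pmull// -p_mod modnMr.
by rewrite {1}x0E Fpi.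
Qed.

(** From index [j], [n * j - j] steps lead to a multiple of [n], and [i] more to [i] modulo [n]. *)
Let p_reach i j : exists d, p i = p (j + d)%N.
Proof.
exists (i + (n * j - j))%N.
by rewrite addnCA subnKC ?leq_pmull// -[RHS]p_mod -modnDmr modnMr addn0 p_mod.
Qed.

Lemma odd_orbit_closure J k : (0 < k)%N -> is_interval J -> orbit_dense J ->
  ((iter k F @` J) `&` J) !=set0 ->
  forall i r, closure (orbit_class J k r) (p i).
Proof.
move=> k0 iJ Jd Jk.
pose C r := closure (orbit_class J k r).
have iC r : is_interval (C r).
  exact/closure_is_interval/orbit_class_interval.
have CF r x : C r x -> C r.+1 (F x).
  by apply: closure_image => _ [m [w Jw <-]]; exists m, w.
have Ck r x : C (r + k)%N x -> C r x.
  apply: closureS => _ [m [w Jw <-]]; exists m.+1, w => //.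
  by rewrite mulnS addnA.
have CFd r d x : C r x -> C (r + d)%N (iter d F x).
  by elim: d => [|d IH] Cx; rewrite ?addn0// addnS; exact/CF/IH.
have Ckd r d x : C (r + k * d)%N x -> C r x.
  elim: d => [|d IH]; first by rewrite muln0 addn0.
  by rewrite mulnSr addnA => /Ck.
have ab : a <= b by move: x0ab; lra.
have [c cab Fc] := fixed_point ab.
(* The fixed point lies in some [C s], hence in all later ones, in particular in [C (r + k * s)],
   which is inside [C r]. *)
have Cc r : C r c.
  have [s Cs] := orbit_class_cover k0 Jd cab.
  have Fic d : iter d F c = c by elim: d => //= d ->.
  apply: (Ckd r s); have := CFd s (r + k * s - s)%N c Cs.
  by rewrite Fic subnKC //; nia.
(* Indices are counted rather than points, so that [F] acts as the cyclic shift. *)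
pose S r : {set 'I_n} := [set i : 'I_n | `[< C r (p i) >]]%SET.
have Scard := @card_shift_constant n k S k0.
have {}Scard : forall r s, (#|S r| <= #|S s|)%N.
  apply: Scard => [r i|r]; last first.
    by apply/fintype.subsetP => i; rewrite !inE; exact: Ck.
  by rewrite !inE /= p_mod; exact: CF.
pose Lft : {set 'I_n} := [set i : 'I_n | p i < c]%SET.
have pc i : p i != c.
  by apply/eqP => pic; have := p_not_fixed i; rewrite pic Fc eqxx.
have card_sides : (#|Lft| + #|~: Lft| = n)%N by rewrite cardsC card_ord.
(* Let [D] be the majority side, contained in [C r0]. All [S r] have the size of [S r0], at least
   that of [D], so none fits in the complement: each meets [D]. *)
have core (D : {set 'I_n}) r0 (i0 : 'I_n) : (#|~: D| < #|D|)%N ->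
    (forall i, i \in D -> C r0 (p i)) ->
    (forall i r, i \in D -> C r (p i) -> C r (p i0)) -> forall r, C r (p i0).
  move=> cD Dr0 Di0 r.
  have : ~~ (S r \subset ~: D).
    apply: contraTN cD => /subset_leq_card h; rewrite -leqNgt.
    apply: leq_trans (leq_trans (Scard r0 r) h); apply: subset_leq_card.
    by apply/fintype.subsetP => i iD; rewrite !inE; exact: Dr0.
  case/subsetPn => i; rewrite !inE negbK => Cri iD.
  exact: Di0 iD Cri.
have [i0 Ci0] : exists i0 : 'I_n, forall r, C r (p i0).
  have [lr|lr] := ltnP #|~: Lft| #|Lft|.
    have [j jL] : exists j, j \in Lft.
      by apply/set0Pn; rewrite -card_gt0; apply: leq_trans lr.
    have [i0 i0L i0max] := @arg_maxP _ _ _ j (mem Lft) (fun i => p i) jL.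
    have {}i0L : i0 \in Lft := i0L.
    rewrite inE in i0L; exists i0.
    (* Some [C r0] contains the endpoint [a]; as an interval through [c], it contains the whole side
       [Lft]. *)
    have [|r0 Cr0] := orbit_class_cover (y := a) k0 Jd; first by rewrite lexx.
    apply: (core Lft r0) => // [i|i r]; rewrite inE => ic.
      apply: (iC r0 a c) => //.
      by have := p_ab i; lra.
    move=> Cri; have ii0 : p i <= p i0 by apply: (i0max i); rewrite [_ i]inE.
    by apply: (iC r (p i) c) => //; rewrite ii0 ltW.
  (* A tie would make [n] even. *)
  have {}lr : (#|Lft| < #|~: Lft|)%N.
    rewrite ltn_neqAle lr andbT; apply/eqP => E; move: n_odd.
    by rewrite -card_sides E addnn odd_double.
  have LftC i : (i \in ~: Lft) = (c < p i).
    by rewrite !inE -leNgt lt_neqAle eq_sym pc.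
  have [j jL] : exists j, j \in ~: Lft.
    by apply/set0Pn; rewrite -card_gt0; apply: leq_trans lr.
  have [i0 i0L i0min] := @arg_minP _ _ _ j (mem (~: Lft)) (fun i => p i) jL.
  have {}i0L : i0 \in ~: Lft := i0L.
  rewrite LftC in i0L; exists i0.
  have [|r0 Cr0] := orbit_class_cover (y := b) k0 Jd.
    by rewrite lexx andbT.
  apply: (core (~: Lft) r0); rewrite ?finset.setCK//;
    [move=> i|move=> i r]; rewrite LftC => ic.
    apply: (iC r0 c b) => //.
    by have := p_ab i; lra.
  move=> Cri; have ii0 : p i0 <= p i by apply: (i0min i); rewrite [_ i]LftC.
  by apply: (iC r c (p i)) => //; rewrite ii0 ltW.
(* Start from [p i0] in the class [r + k * d - d]: after [d] steps it is in [C (r + k * d)], hence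
   in [C r]. *)
move=> i r; have [d ->] := p_reach i i0.
apply: (Ckd r d); rewrite [X in p X]addnC pD.
by have := CFd (r + k * d - d)%N d _ (Ci0 _); rewrite subnK //; nia.
Qed.

(** To pass from the closures to the classes: the middle one of three distinct orbit points lies
    strictly between points of the closure, hence in the class itself, and iteration carries it to
    all others. *)
Lemma odd_orbit_class J k : (0 < k)%N -> is_interval J -> orbit_dense J ->
  ((iter k F @` J) `&` J) !=set0 -> forall i r, orbit_class J k r (p i).
Proof.
move=> k0 iJ Jd Jk.
have Cp := odd_orbit_closure k0 iJ Jd Jk.
have iW r := orbit_class_interval (r := r) iJ Jk.
have p02 : p 0%N != p 2%N.
  (* Otherwise all even-indexed points equal [p 0], among them [p (n - 1)], whose image is
     [p n = p 0]: a fixed point. *)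
  apply/eqP => p02; have p2j j : p j.*2 = p 0%N.
    by elim: j => // j IH; rewrite doubleS -add2n pD IH -[LHS]/(p 2%N).
  have nE : n = n./2.*2.+1 by rewrite -[LHS]odd_double_half n_odd.
  have := p_not_fixed n./2.*2; rewrite -[F _]/(p n./2.*2.+1) -nE p2j.
  by rewrite /p x0n eqxx.
have p01 : p 0%N != p 1%N by rewrite eq_sym; exact: (p_not_fixed 0).
have p12 : p 1%N != p 2%N by rewrite eq_sym; exact: (p_not_fixed 1).
have [_ [_ [_ [[u ->] [v ->] [w ->] uvw]]]] :=
  @between_distinct _ _ _ p01 p12 p02 (fun y => exists i, y = p i)
  (ex_intro _ 0 erefl) (ex_intro _ 1 erefl) (ex_intro _ 2 erefl).
have Wv r : orbit_class J k r (p v).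
  exact: closure_between (iW r) (Cp u r) (Cp w r) uvw.
move=> i r; have [d ->] := p_reach i v.
have [m [y Jy yE]] := Wv (r + k * d - d)%N.
exists (d + m)%N, y => //; rewrite [in p _]addnC pD -yE -iterD.
by congr (iter _ F _); nia.
Qed.

Hypothesis Ftrans : forall x y, a <= x <= b -> a <= y <= b ->
  forall e, 0 < e -> exists i z,
    [/\ (0 < i)%N, a <= z <= b, `|x - z| < e & `|y - iter i F z| < e].

Lemma iter_ab i z : a <= z <= b -> a <= iter i F z <= b.
Proof. by move=> zab; elim: i => //= i; exact: Fab. Qed.

(** The image of [[a, b]] is compact, hence closed, and it is dense because transitivity provides
    positive times. *)
Lemma transitive_surjective i y : a <= y <= b ->
  exists2 x, a <= x <= b & iter i F x = y.
Proof.
have Fsurj z : a <= z <= b -> exists2 x, a <= x <= b & F x = z.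
  move=> zab; have : closed (F @` `[a, b]).
    apply: (compact_closed (@norm_hausdorff _ _)).
    apply: continuous_compact (@segment_compact _ _ _).
    exact: continuous_subspaceT.
  move/closure_id => clF; suff [x] : (F @` `[a, b]) z.
    by rewrite /= in_itv /= => xab <-; exists x.
  rewrite clF; apply/closure_distP => e e0.
  have [[|m] [w [//_ wab _ we]]] := Ftrans zab zab e0.
  exists (iter m.+1 F w) => //; exists (iter m F w) => //.
  by rewrite /= in_itv /=; exact: iter_ab.
move=> yab; elim: i => [|i [x xab <-]]; first by exists y.
by have [w wab <-] := Fsurj _ xab; exists w => //; rewrite -iterSr.
Qed.

(** Write [y] as the [i]-th image of [u]: the orbit of the ball passes near [u], and continuity of
    the [i]-th iterate transports this to [y]. *)
Lemma orbit_dense_ball x e i : a <= x <= b -> 0 < e ->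
  orbit_dense (iter i F @` [set z | a <= z <= b /\ `|x - z| < e]).
Proof.
move=> xab e0 y yab d d0; have [u uab uy] := transitive_surjective i yab.
have /nbhs_ballP[r /= r0 ur] : nbhs u (iter i F @^-1` ball (iter i F u) d).
  by apply: (continuous_iter cF); exact: nbhsx_ballx.
have [|j [z [_ zab xz uz]]] := Ftrans xab uab (e := Num.min e r).
  by rewrite lt_min e0.
exists j, (iter i F z).
  by exists z => //; split=> //; rewrite (lt_le_trans xz)// ge_min lexx.
rewrite -iterD addnC iterD -uy; apply: ur.
by rewrite /ball /= (lt_le_trans uz)// ge_min lexx orbT.
Qed.

Lemma transitive_odd_mixing x y e : a <= x <= b -> a <= y <= b -> 0 < e ->
  exists N, forall m, (N <= m)%N ->
    exists z, [/\ a <= z <= b, `|x - z| < e & `|y - iter m F z| < e].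
Proof.
move=> xab yab e0; pose J := [set z | a <= z <= b /\ `|x - z| < e].
have iJ : is_interval J.
  move=> u v [uab xu] [vab xv] w uwv; move: xu xv; rewrite !ltr_norml => xu xv.
  by split; rewrite ?ltr_norml; lra.
have [k [z [k0 zab xz xzk]]] := Ftrans xab xab e0.
have Jk : ((iter k F @` J) `&` J) !=set0.
  by exists (iter k F z); split; [exists z|split=> //; exact: iter_ab].
have Jd i : orbit_dense (iter i F @` J) by exact: orbit_dense_ball.
have Jd0 : orbit_dense J by move: (Jd 0); rewrite image_id.
(* Some iterate [J1] of [J] contains [x0]. Since [x0] returns after [n] steps, the same lemma
   applies to [J1] with step [n]. *)
have [q p0J] := odd_orbit_class k0 iJ Jd0 Jk 0 0.
set i1 := (0 + k * q)%N in p0J.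
pose J1 := iter i1 F @` J; have iJ1 : is_interval J1 by exact: is_interval_iter.
have J1n : ((iter n F @` J1) `&` J1) !=set0.
  by exists x0; split=> //; exists x0.
have /choice[h hP] := fun i : 'I_n => odd_orbit_class n_gt0 iJ1 (Jd i1) J1n i 0.
pose M := \max_(i < n) h i.
(* The [n]-th iterate fixes each [p i], so the exponents [n * h i] can all be raised to [n * M]. *)
have PJ i : (iter (n * M) F @` J1) (p i).
  rewrite -p_mod -[(i %% n)%N]/(nat_of_ord (Ordinal (ltn_pmod i n_gt0))).
  set i' := Ordinal _; have [w J1w wE] := hP i'.
  have hM : (h i' <= M)%N by exact: leq_bigmax.
  exists w => //; rewrite -(subnK hM) mulnDr iterD wE -pD.
  by rewrite -[LHS]p_mod mulnC modnMDl p_mod.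
pose L := [set z | exists i j, p i <= z <= p j].
have Lp i : L (p i) by exists i, i; rewrite lexx.
have iL : is_interval L.
  move=> u v [i [_ /andP[iu _]]] [_ [j /andP[_ vj]]] w /andP[uw wv].
  by exists i, j; rewrite (le_trans iu uw) (le_trans wv vj).
have LJ : L `<=` iter (n * M) F @` J1.
  move=> u [i [j iuj]].
  exact: (is_interval_iter (n := n * M) iJ1) (PJ i) (PJ j) _ iuj.
(* The image of the hull [L] is an interval containing every orbit point, so [L] lies in its own
   image. *)
have LF d : L `<=` iter d F @` L.
  elim: d => [|d IH] u Lu; first by exists u.
  have [v Lv <-] := IH _ Lu; case: Lv => i [j ivj].
  have FLp l : (F @` L) (p l).
    exists (p (l + n.-1)%N) => //; rewrite -[F _]/(p (l + n.-1).+1).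
    by rewrite -addnS prednK// -p_mod modnDr p_mod.
  have [v' Lv' <-] := is_interval_iter (n := 1) iL (FLp i) (FLp j) ivj.
  by exists v' => //; rewrite -iterSr.
have [s [t pst]] : exists s t, p s < p t.
  case: (ltgtP (p 0%N) (p 1%N)) => [?|?|E]; [by exists 0, 1|by exists 1, 0|].
  by move: x0F; rewrite -[F x0]/(p 1%N) -E eqxx.
(* A point [w] close to [mid] is in [L] and comes near [y] at time [m0]; pulling [w] back inside [L]
   by [d] steps gives all later times. *)
pose mid := (p s + p t) / 2.
have midab : a <= mid <= b.
  by have := p_ab s; have := p_ab t; rewrite /mid; lra.
have [|m0 [w [_ wab midw yw]]] :=
  Ftrans midab yab (e := Num.min e ((p t - p s) / 2)).
  by rewrite lt_min e0; lra.
have Lw : L w.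
  exists s, t; move: midw; rewrite lt_min /mid => /andP[_].
  by rewrite ltr_norml; lra.
exists (n * M + i1 + m0)%N => m Nm.
set d := (m - (n * M + i1 + m0))%N; have [u Lu uw] := LF d _ Lw.
have [_ [v [vab xv] <-] vu] := LJ _ Lu.
exists v; split=> //; rewrite -(subnKC Nm) -/d -addnA addnC !iterD vu uw.
by rewrite (lt_le_trans yw)// ge_min lexx.
Qed.

End odd_orbit.
End reals.

(** * Mixing maps and their action on measures *)

Section mixture.
Context d (T : measurableType d) (R : realType) (K : nat).
Variables (w : nat -> {nonneg R}) (P : nat -> probability T R).
Hypothesis w1 : \sum_(i < K) (w i)%:num = 1.

Let mix : set T -> \bar R := msum (fun i => mscale (w i) (P i)) K.

HB.instance Definition _ := Measure.on mix.

Let mix_setT : mix setT = 1%E.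
Proof.
rewrite /mix /msum /= -w1 -sumEFin; apply: eq_bigr => i _.
by rewrite /mscale [X in (_ * X)%E](probability_setT (P i)) mule1.
Qed.

HB.instance Definition _ := Measure_isProbability.Build _ _ _ mix mix_setT.

Definition mixture : probability T R := mix.

Lemma mixtureE A : mixture A = (\sum_(i < K) (w i)%:num%:E * P i A)%E.
Proof. by []. Qed.

End mixture.

Lemma probability_real d (T : measurableType d) (R : realType)
  (P : probability T R) A : measurable A -> exists p : R, P A = p%:E.
Proof. by move=> mA; exists (fine (P A)); rewrite fineK// fin_num_measure. Qed.

Lemma probability_overlap d (T : measurableType d) (R : realType)
    (P : probability T R) A B : measurable A -> measurable B ->
  (1 < P A + P B)%E -> A `&` B !=set0.
Proof.
move=> mA mB AB; apply/set0P; apply: contraTneq AB => AB0.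
by rewrite -leNgt -measureU//; apply: probability_le1; exact: measurableU.
Qed.

Section prohorov_mass.
Variables (R : realType) (X : pmetricType R).
Implicit Types mu nu : borel_probability X.

Lemma prohorov_bound_le mu nu e :
  prohorov_bounds mu nu e -> prohorov mu nu <= e.
Proof. by apply: ge_inf; case: (prohorov_bounds_inf mu nu). Qed.

(** A bound [e1 < e] is applied to the enlargement of [B] by [e - e1]; hence the assumption on all
    enlargements, which are measurable. *)
Lemma prohorov_lt_enlarge mu nu (B : set X) (c : \bar R) e :
  prohorov mu nu < e -> (forall r, 0 < r -> (c <= mu (enlarge B r))%E) ->
  (c <= nu (enlarge B e) + e%:E)%E.
Proof.
rewrite -subr_gt0 => e0 cmu.
have [e1 [e10 b1] e1e] := inf_adherent e0 (prohorov_bounds_inf mu nu).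
rewrite -/(prohorov mu nu) subrKC in e1e.
have r0 : 0 < e - e1 by rewrite subr_gt0.
have [h _] := b1 _ (measurable_enlarge B (e - e1)).
apply: (le_trans (cmu _ r0)); apply: (le_trans h); apply: leeD; last first.
  by rewrite lee_fin ltW.
apply: le_measure; rewrite ?inE; [exact: measurable_enlarge..|].
by move=> x /enlarge_comp; rewrite subrK.
Qed.

(** Here [nu] arises from [mu] by redistributing the mass of each piece [J j] within the small set
    [B j] according to [kap j]. It serves both for the measure built near the source and for its
    image near the target. *)
Lemma prohorov_bounds_partition mu nu K (J : nat -> set (borel X))
    (B : nat -> set X) (kap : nat -> probability (borel X) R) e :
  0 < e -> (forall j, measurable (J j)) -> trivIset setT J ->
  \big[setU/set0]_(j < K) J j = setT -> (forall j, J j `<=` B j) ->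
  (forall j x y, B j x -> B j y -> mdist x y < e) ->
  (forall j (A : set (borel X)), (j < K)%N -> measurable A ->
    B j `<=` A -> kap j A = 1%E) ->
  (forall j (A : set (borel X)), (j < K)%N -> measurable A ->
    B j `&` A = set0 -> kap j A = 0%E) ->
  (forall A : set (borel X), measurable A ->
    nu A = \sum_(j < K) mu (J j) * kap j A)%E ->
  prohorov_bounds mu nu e.
Proof.
move=> e0 mJ tJ JT JB Be kap1 kap0 nuE; split=> // A mA.
have mAe := measurable_enlarge A e.
have muE C : measurable C -> mu C = (\sum_(j < K) mu (C `&` J j))%E.
  move=> mC; rewrite -{1}(setIT C) -JT big_distrr /=.
  rewrite (@measure_bigsetU _ _ _ mu (fun j => C `&` J j))// => [j|].
    exact: measurableI.
  exact: (@trivIset_setIl _ _ _ _ (fun=> C) tJ).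
have Bnear j x : B j x -> A x -> B j `<=` enlarge A e.
  by move=> Bx Ax y By; apply/enlargeP; exists x => //; exact: Be Bx.
(* A [B j] missing [A] contributes nothing to [nu A]; any other lies in the enlargement of [A]. *)
have empty j : B j `&` A = set0 \/ B j `<=` enlarge A e.
  have [|/set0P[x [Bx Ax]]] := eqVneq (B j `&` A) set0; first by left.
  by right; exact: Bnear Bx Ax.
suff [h1 h2] : (mu A <= nu (enlarge A e))%E /\ (nu A <= mu (enlarge A e))%E.
  by split; [apply: (le_trans h1)|apply: (le_trans h2)];
    rewrite leeDl// lee_fin ltW.
split.
  rewrite nuE // muE //; apply: lee_sum => /= j _.
  have [BA|BA] := empty j.
    rewrite (_ : A `&` J j = set0) ?measure0; last first.
      by apply/seteqP; split=> // x [Ax /JB Bx]; rewrite -BA.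
    by rewrite mule_ge0.
  rewrite (kap1 j) // mule1; apply: le_measure; rewrite ?inE //.
  exact: measurableI.
rewrite nuE // muE //; apply: lee_sum => /= j _.
have [BA|BA] := empty j; first by rewrite (kap0 j) // mule0.
rewrite (setIidr (subset_trans (JB j) BA)).
by rewrite -[leRHS]mule1; apply: lee_wpmul2l => //; exact: probability_le1.
Qed.

Lemma induced_map_iterE (f : X -> X) (cf : continuous f) mu n A :
  iter n (induced_map cf) mu A = mu (iter n f @^-1` A).
Proof.
elim: n A => // n IH A.
rewrite iterS induced_mapE IH; congr (mu _).
Qed.

Lemma prohorov_open_nbhs mu e : 0 < e -> exists U : set (borel_probability X),
  [/\ open U, U mu & forall nu, U nu -> prohorov mu nu < e].
Proof.
move=> e0; exists (ball mu e)^°; split; first exact: open_interior.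
  exact: nbhsx_ballx.
by move=> nu /interior_subset.
Qed.


Definition dirac_prob (x : X) : borel_probability X :=
  (dirac (x : borel X) : probability (borel X) R).

Lemma dirac_probE x (A : set X) : dirac_prob x A = ((x \in A)%:R)%:E.
Proof. by rewrite /dirac_prob /= diracE. Qed.

Lemma dirac_prob_enlarge x nu e :
  prohorov (dirac_prob x) nu < e -> (1 <= nu (enlarge [set x] e) + e%:E)%E.
Proof.
move=> xnu; apply: (prohorov_lt_enlarge xnu) => r r0.
by rewrite dirac_probE mem_set//; exact: sub_enlarge.
Qed.

Lemma measurable_preimage_iter (f : X -> X) n (A : set X) :
  continuous f -> measurable (A : set (borel X)) ->
  measurable (iter n f @^-1` A : set (borel X)).
Proof.
move=> cf mA; rewrite -[X in measurable X]setTI.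
have := continuous_borel_measurable (continuous_iter (n := n) cf).
by apply; [exact: measurableT|].
Qed.

Lemma enlarge1_sub (x : X) e U : ball x e `<=` U -> enlarge [set x] e `<=` U.
Proof.
move=> eU y /enlargeP[_ -> yx]; apply: eU.
by rewrite ballEmdist /= metric_sym.
Qed.

Lemma induced_transitive_transitive (f : X -> X) (cf : continuous f) :
  topologically_transitive (induced_map cf) -> topologically_transitive f.
Proof.
move=> tr U V oU oV [x Ux] [y Vy].
have /nbhs_ballP[r /= r0 rU] : nbhs x U by exact: open_nbhs_nbhs.
have /nbhs_ballP[s /= s0 sV] : nbhs y V by exact: open_nbhs_nbhs.
(* With [e] at most 1/3, the two events below have mass at least 2/3 each, so they overlap. *)
pose e := Num.min (Num.min r s) 3^-1.
have e0 : 0 < e by rewrite !lt_min r0 s0 /=; lra.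
have [er es e3] : [/\ e <= r, e <= s & e <= 3^-1].
  by split; rewrite /e !ge_min !lexx ?orbT.
have [U' [oU' U'x U'e]] := prohorov_open_nbhs (dirac_prob x) e0.
have [V' [oV' V'y V'e]] := prohorov_open_nbhs (dirac_prob y) e0.
have [n n1 [_ [[mu /U'e xmu <-] /V'e]]] :=
  tr U' V' oU' oV' (ex_intro _ _ U'x) (ex_intro _ _ V'y).
move/dirac_prob_enlarge; have := dirac_prob_enlarge xmu.
rewrite induced_map_iterE.
set A := enlarge [set x] e; set B := _ @^-1` _ => hA hB.
have mA : measurable (A : set (borel X)) by exact: measurable_enlarge.
have mB : measurable (B : set (borel X)).
  exact (measurable_preimage_iter n cf (measurable_enlarge _ _)).
have [|z [Az Bz]] := probability_overlap (P := mu) mA mB.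
  have [p pE] := probability_real mu mA; have [q qE] := probability_real mu mB.
  move: hA hB; rewrite pE qE -!EFinD !lee_fin lte_fin; lra.
exists n => //; exists (iter n f z); split.
  exists z => //.
  by apply: (enlarge1_sub (subset_trans _ rU)) Az; exact: le_ball.
by apply: (enlarge1_sub (subset_trans _ sV)) Bz; exact: le_ball.
Qed.

Lemma mixing_induced_transitive (f : X -> X) (cf : continuous f) :
  compact [set: X] ->
  (forall x y e, 0 < e -> exists N, forall m, (N <= m)%N ->
    exists z, mdist x z < e /\ mdist y (iter m f z) < e) ->
  topologically_transitive (induced_map cf).
Proof.
move=> cX mix U V oU oV [mu Umu] [nu Vnu].
have /nbhs_ballP[r /= r0 rU] : nbhs mu U by exact: open_nbhs_nbhs.
have /nbhs_ballP[s /= s0 sV] : nbhs nu V by exact: open_nbhs_nbhs.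
pose e := Num.min r s / 2.
have e0 : 0 < e by rewrite divr_gt0// lt_min r0 s0.
have [er es] : e < r /\ e < s.
  suff : 2 * e <= r /\ 2 * e <= s by lra.
  by rewrite /e mulrC divfK// !ge_min !lexx orbT.
have e20 : 0 < e / 2 by lra.
have [x [K xK]] : exists (x : nat -> X) K,
    forall y, exists2 i, (i < K)%N & mdist (x i) y < e / 2.
  move: cX; rewrite compact_cover.
  case/(_ X setT (fun x => enlarge [set x] (e / 2))) => [x _|y _|D _ XD].
    exact: open_enlarge.
    by exists y => //; exact: sub_enlarge.
  exists (nth point (finmap.enum_fset D)), (size (finmap.enum_fset D)) => y.
  have [//|i Di /enlargeP[_ -> yi]] := XD y.
  exists (index i (finmap.enum_fset D)); first by rewrite index_mem.
  by rewrite nth_index// metric_sym.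
pose B i : set (borel X) := enlarge [set x i] (e / 2).
have BE i y : B i y <-> mdist (x i) y < e / 2.
  rewrite /B; split=> [/enlargeP[_ -> ]|xy]; first by rewrite metric_sym.
  by apply/enlargeP; exists (x i); rewrite // metric_sym.
have mB i : measurable (B i) by exact: measurable_enlarge.
pose J := seqDU B.
have mJ i : measurable (J i) by exact: seqDU_measurable.
have tJ : trivIset setT J by exact: trivIset_seqDU.
have JT : \big[setU/set0]_(i < K) J i = setT.
  rewrite -bigsetU_seqDU -bigcup_mkord; apply/seteqP; split=> // y _.
  by have [i iK xy] := xK y; exists i => //; exact/BE.
have JB i : J i `<=` B i by exact: subset_seqDU.
have Be i y z : B i y -> B i z -> mdist y z < e.
  move=> /BE xy /BE xz; apply: le_lt_trans (metric_triangle _ (x i) _) _.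
  by rewrite metric_sym; lra.
pose wt (la : borel_probability X) i : {nonneg R} :=
  NngNum (fine_ge0 (measure_ge0 la (J i))).
have wtE la i : ((wt la i)%:num%:E = la (J i))%E.
  by rewrite /= fineK// fin_num_measure.
have wt1 la : \sum_(i < K) (wt la i)%:num = 1.
  apply: EFin_inj; rewrite -sumEFin -(probability_setT la) -JT.
  by rewrite measure_bigsetU//; apply: eq_bigr => i _; rewrite wtE.
have [N NP] := choice (fun ij : nat * nat => mix (x ij.1) (x ij.2) _ e20).
(* One time serves all pairs of pieces; the successor makes it positive. *)
pose n := (\max_(i < K) \max_(j < K) N (i : nat, j : nat)).+1.
have /choice[z zP] (ij : nat * nat) : exists z,
    (ij.1 < K)%N -> (ij.2 < K)%N -> B ij.1 z /\ B ij.2 (iter n f z).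
  case: (ltnP ij.1 K) => iK; last by exists point.
  case: (ltnP ij.2 K) => jK; last by exists point.
  have [|z [xz yz]] := NP ij n; last by exists z => _ _; split; exact/BE.
  apply/leqW; apply: leq_trans (leq_bigmax (Ordinal iK)).
  by apply: leq_trans (leq_bigmax (Ordinal jK)); case: ij iK jK.
(* [m] has weight [mu (J i) * nu (J j)] at [z (i, j)]. Grouped by [i] it is a mixture of the
   [kap i], carried by [B i]; grouped by [j], its [n]-th image is a mixture of the [kap' j], carried
   by [B j]. *)
pose kap i := mixture (fun j => dirac_prob (z (i, j))) (wt1 nu).
pose m : borel_probability X := mixture kap (wt1 mu).
pose kap' j := mixture (fun i => dirac_prob (iter n f (z (i, j)))) (wt1 mu).
have mU : U m.
  apply: rU; apply: le_lt_trans er; apply: prohorov_bound_le.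
  apply: (@prohorov_bounds_partition _ _ K J B kap) => //.
  - move=> i A iK mA BA; rewrite mixtureE -(probability_setT nu) -JT.
    rewrite measure_bigsetU//; apply: eq_bigr => j _; rewrite wtE.
    rewrite dirac_probE mem_set ?mule1//; apply: BA.
    by have [] := zP (i, nat_of_ord j) iK (ltn_ord j).
  - move=> i A iK mA BA; rewrite mixtureE big1// => j _.
    rewrite dirac_probE memNset ?mule0// => Az.
    suff : (B i `&` A) (z (i, nat_of_ord j)) by rewrite BA.
    by split=> //; have [] := zP (i, nat_of_ord j) iK (ltn_ord j).
  - by move=> A mA; rewrite mixtureE; apply: eq_bigr => i _; rewrite wtE.
have mV : V (iter n (induced_map cf) m).
  apply: sV; apply: le_lt_trans es; apply: prohorov_bound_le.
  apply: (@prohorov_bounds_partition _ _ K J B kap') => //.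
  - move=> j A jK mA BA; rewrite mixtureE -(probability_setT mu) -JT.
    rewrite measure_bigsetU//; apply: eq_bigr => i _; rewrite wtE.
    rewrite dirac_probE mem_set ?mule1//; apply: BA.
    by have [] := zP (nat_of_ord i, j) (ltn_ord i) jK.
  - move=> j A jK mA BA; rewrite mixtureE big1// => i _.
    rewrite dirac_probE memNset ?mule0// => Az.
    suff : (B j `&` A) (iter n f (z (nat_of_ord i, j))) by rewrite BA.
    by split=> //; have [] := zP (nat_of_ord i, j) (ltn_ord i) jK.
  - move=> A mA; rewrite induced_map_iterE mixtureE.
    transitivity (\sum_(i < K) \sum_(j < K)
        (mu (J i) *
         (nu (J j) * dirac_prob (iter n f (z (i : nat, j : nat))) A)))%E.
      apply: eq_bigr => i _; rewrite mixtureE ge0_sume_distrr => [|j _].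
        by apply: eq_bigr => j _; rewrite !wtE !dirac_probE.
      by rewrite mule_ge0.
    rewrite exchange_big; apply: eq_bigr => j _.
    rewrite mixtureE ge0_sume_distrr => [|i _]; last by rewrite mule_ge0.
    by apply: eq_bigr => i _; rewrite wtE muleCA.
by exists n => //; exists (iter n (induced_map cf) m); split=> //; exists m.
Qed.
End prohorov_mass.

(** * Maps of a compact interval *)

Section interval.
Variables (R : realType) (a b : R) (ab : a <= b).
Local Notation I := (compact_itv ab).
Implicit Types x y : I.

Lemma clamp_subproof (t : R) : Num.max a (Num.min b t) \in `[a, b]%classic.
Proof. by rewrite inE /= in_itv /= le_max lexx ge_max ab ge_min lexx. Qed.

(** The retraction of the line onto the interval, used to extend interval maps to the line. *)
Definition clamp (t : R) : I := 
  exist (fun u => u \in `[a, b]%classic) _ (clamp_subproof t).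

Lemma itv_bounds x : a <= set_val x <= b.
Proof. by have := set_valP x; rewrite /= in_itv. Qed.

Lemma clampE t : a <= t <= b -> set_val (clamp t) = t.
Proof.
case/andP=> at_ tb; rewrite -[LHS]/(Num.max a (Num.min b t)).
by rewrite (min_idPr tb) (max_idPr at_).
Qed.

Lemma clampK x : clamp (set_val x) = x.
Proof. by apply: val_inj; exact: clampE (itv_bounds x). Qed.

Lemma mdist_itvE x y : mdist x y = `|set_val x - set_val y|.
Proof. by []. Qed.

Lemma clamp_lipschitz s t :
  `|set_val (clamp s) - set_val (clamp t)| <= `|s - t|.
Proof.
rewrite -[set_val (clamp s)]/(Num.max a (Num.min b s)).
rewrite -[set_val (clamp t)]/(Num.max a (Num.min b t)).
rewrite !maxEle !minEle; case: (leP b s) => bs; case: (leP b t) => bt;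
  case: (leP a b) ab => // ab' _;
  case: (leP a s) => as_; case: (leP a t) => at_;
  case: (ger0P (s - t)) => st; rewrite ?ler_norml ?normr0; lra.
Qed.

Lemma continuous_clamp : continuous clamp.
Proof.
move=> t B /nbhs_ballP[e /= e0 eB]; apply/nbhs_ballP; exists e => //= s ts.
apply: eB; rewrite ballEmdist /= mdist_itvE.
exact: le_lt_trans (clamp_lipschitz _ _) ts.
Qed.

Lemma continuous_set_val : continuous (set_val : I -> R).
Proof.
move=> x B /nbhs_ballP[e /= e0 eB]; apply/nbhs_ballP; exists e => //= y xy.
exact: eB.
Qed.

Lemma transitive_itvP (f : I -> I) : topologically_transitive f <->
  forall x y e, 0 < e ->
    exists i z, [/\ (0 < i)%N, mdist x z < e & mdist y (iter i f z) < e].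
Proof.
split=> [tr x y e e0|tr U V oU oV [x Ux] [y Vy]].
  have [||i i0 [_ [[z xz <-] yz]]] :=
      tr _ _ (@open_interior _ (ball x e)) (@open_interior _ (ball y e)).
  - by exists x; exact: nbhsx_ballx.
  - by exists y; exact: nbhsx_ballx.
  by exists i, z; move: xz yz => /interior_subset xz /interior_subset yz; split.
have /nbhs_ballP[r /= r0 rU] : nbhs x U by exact: open_nbhs_nbhs.
have /nbhs_ballP[s /= s0 sV] : nbhs y V by exact: open_nbhs_nbhs.
have [|i [z [i0 xz yz]]] := tr x y (Num.min r s); first by rewrite lt_min r0.
exists i => //; exists (iter i f z); split.
  exists z => //; apply: rU.
  by rewrite ballEmdist /= (lt_le_trans xz)// ge_min lexx.
by apply: sV; rewrite ballEmdist /= (lt_le_trans yz)// ge_min lexx orbT.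
Qed.

Lemma transitive_itv_odd_mixing (f : I -> I) x0 n :
  continuous f -> topologically_transitive f ->
  has_least_period f x0 n -> odd n -> n <> 1%N ->
  forall x y e, 0 < e -> exists N, forall m, (N <= m)%N ->
    exists z, mdist x z < e /\ mdist y (iter m f z) < e.
Proof.
move=> cf /transitive_itvP tr [n0 x0n x0min] n_odd n1 x y e e0.
(* The iterates of [F] agree with those of [f] on the interval, so the results on the line apply. *)
pose F t := set_val (f (clamp t)).
have cF : continuous F.
  move=> t; apply: (@continuous_comp _ _ _ (f \o clamp) set_val).
    by apply: continuous_comp; [exact: continuous_clamp|exact: cf].
  exact: continuous_set_val.
have Fval i (z : I) : iter i F (set_val z) = set_val (iter i f z).
  by elim: i => //= i ->; rewrite /F clampK.
have Fab t : a <= t <= b -> a <= F t <= b by move=> _; exact: itv_bounds.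
have x0F : F (set_val x0) != set_val x0.
  apply/eqP; rewrite -[F _]/(iter 1 F _) Fval => /val_inj; apply: x0min.
  by apply/andP; split=> //; rewrite ltn_neqAle n0 andbT eq_sym; exact/eqP.
have x0Fn : iter n F (set_val x0) = set_val x0 by rewrite Fval x0n.
have Ftrans s t : a <= s <= b -> a <= t <= b -> forall d, 0 < d -> exists i z,
    [/\ (0 < i)%N, a <= z <= b, `|s - z| < d & `|t - iter i F z| < d].
  move=> sab tab d d0; have [i [z [i0 sz tz]]] := tr (clamp s) (clamp t) d d0.
  exists i, (set_val z); rewrite Fval -{1}(clampE sab) -(clampE tab).
  by split=> //; exact: itv_bounds.
have [N NP] := transitive_odd_mixing cF Fab (itv_bounds x0) x0Fn n_odd x0F
  Ftrans (itv_bounds x) (itv_bounds y) e0.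
exists N => m /NP[t [tab xt yt]]; exists (clamp t).
by rewrite !mdist_itvE -Fval clampE.
Qed.

End interval.

(** * The counterexample: a square root of the tent map *)

Section square_root_of_tent.
Variable R : realType.
Implicit Types t u v : R.

Definition tent u := if u <= 2^-1 then 2 * u else 2 - 2 * u.

Definition flip_tent t := if t <= 0 then - t else - tent t.

Lemma tent_itv u : 0 <= u <= 1 -> 0 <= tent u <= 1.
Proof. by rewrite /tent; case: ifPn => *; lra. Qed.

(** Each half of [[0, 1]] is stretched onto [[0, 1]] by a factor 2; pulling back along the half
    containing [u] halves the distance. *)
Lemma iter_tent_onto m u v : 0 <= u <= 1 -> 0 <= v <= 1 ->
  exists w, [/\ 0 <= w <= 1, `|u - w| <= 2^-1 ^+ m & iter m tent w = v].
Proof.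
move=> + v01; elim: m u => [|m IH] u u01.
  by exists v; split=> //; rewrite expr0 ler_norml; lra.
have [w [w01 uw wv]] := IH _ (tent_itv u01).
move: uw; rewrite /tent exprS; case: ifPn => u2; rewrite ler_norml => uw.
  exists (w / 2); split; [lra|rewrite ler_norml; lra|rewrite iterSr /tent].
  by rewrite ifT; [rewrite mulrC divfK|lra].
exists (1 - w / 2); split; [lra|rewrite ler_norml; lra|rewrite iterSr /tent].
rewrite -[RHS]wv; congr (iter _ _ _); case: ifPn => ?; lra.
Qed.

Lemma flip_tent_le0 t : t <= 0 -> flip_tent t = - t.
Proof. by rewrite /flip_tent => ->. Qed.

Lemma flip_tent_ge0 t : 0 <= t -> flip_tent t = - tent t.
Proof. by rewrite /flip_tent /tent => t0; do ?case: ifPn => ?; lra. Qed.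

Lemma flip_tent_itv t : -1 <= t <= 1 -> -1 <= flip_tent t <= 1.
Proof. by rewrite /flip_tent /tent; do ?case: ifPn => ?; lra. Qed.

Lemma flip_tent_lipschitz s t : `|flip_tent s - flip_tent t| <= 2 * `|s - t|.
Proof.
rewrite /flip_tent /tent; case: (ger0P (s - t)) => st;
  do ?case: ifPn => ?; rewrite ler_norml; lra.
Qed.

Lemma iter_flip_tent_double m t : 0 <= t <= 1 ->
  iter m.*2 flip_tent t = iter m tent t.
Proof.
elim: m t => // m IH t t01.
rewrite doubleS !iterSr -IH; last exact: tent_itv.
congr (iter _ _ _); have [t0 tt0] : 0 <= t /\ 0 <= tent t.
  by have := tent_itv t01; lra.
by rewrite (flip_tent_ge0 t0) flip_tent_le0 ?opprK ?oppr_le0.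
Qed.

Lemma iter_flip_tent_onto t v e : -1 <= t <= 1 -> -1 <= v <= 1 -> 0 < e ->
  exists i w, [/\ (0 < i)%N, -1 <= w <= 1, `|t - w| < e
                & iter i flip_tent w = v].
Proof.
move=> + v1 e0.
have [m me] : exists m, (2^-1 : R) ^+ m.+1 < e.
  exists (Num.trunc e^-1); rewrite exprVn invf_plt ?posrE ?exprn_gt0//.
  apply: lt_trans (truncnS_gt _) _.
  by rewrite -natrX ltr_nat ltn_expl.
have pos u : 0 <= u <= 1 -> exists i w,
    [/\ (0 < i)%N, 0 <= w <= 1, `|u - w| < e & iter i flip_tent w = v].
  move=> u01; have [v0|v0] := leP 0 v.
    have [||w [w01 uw wv]] := @iter_tent_onto m.+1 u v; [lra|lra|].
    exists m.+1.*2, w; split=> //; first exact: le_lt_trans me.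
    by rewrite iter_flip_tent_double.
  (* Negative targets need one extra step: [flip_tent] sends [- v / 2] to [v]. *)
  have [||w [w01 uw wv]] := @iter_tent_onto m.+1 u (- v / 2); [lra|lra|].
  exists m.+1.*2.+1, w; split=> //; first exact: le_lt_trans me.
  rewrite iterS iter_flip_tent_double// wv flip_tent_ge0 ?/tent; last lra.
  by case: ifPn => *; lra.
move=> t1; have [t0|t0] := leP 0 t.
  have [|i [w [i0 w01 tw wv]]] := pos t; first by lra.
  by exists i, w; split=> //; lra.
have [|i [w [i0 w01 tw wv]]] := pos (- t); first by lra.
exists i.+1, (- w); split=> //; first by lra.
  by move: tw; rewrite !ltr_norml; lra.
by rewrite iterSr -wv flip_tent_le0 ?opprK//; lra.
Qed.

(** The halves are exchanged at every step. This parity obstruction excludes both odd periods and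
    transitivity on measures. *)
Lemma iter_flip_tent_sign n t : 0 <= t <= 1 ->
  if odd n then -1 <= iter n flip_tent t <= 0 else 0 <= iter n flip_tent t <= 1.
Proof.
move=> t01; elim: n => //= n; case: odd => /= h.
  by rewrite flip_tent_le0; lra.
have : 0 <= tent (iter n flip_tent t) <= 1 by exact: tent_itv.
by rewrite flip_tent_ge0; lra.
Qed.

Lemma neg1_le1 : (-1 : R) <= 1. Proof. by lra. Qed.

Local Notation I := (compact_itv neg1_le1).

Definition flip_tent_map (x : I) : I := clamp _ (flip_tent (set_val x)).

Lemma iter_flip_tent_map n x :
  set_val (iter n flip_tent_map x) = iter n flip_tent (set_val x).
Proof.
elim: n => // n IH; rewrite !iterS -IH; apply: clampE.
exact/flip_tent_itv/itv_bounds.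
Qed.

Lemma continuous_flip_tent_map : continuous flip_tent_map.
Proof.
move=> x B /nbhs_ballP[e /= e0 eB]; apply/nbhs_ballP; exists (e / 2) => /=.
  by lra.
move=> y xy.
apply: eB; rewrite ballEmdist /= mdist_itvE.
apply: le_lt_trans (clamp_lipschitz _ _ _) _.
apply: le_lt_trans (flip_tent_lipschitz _ _) _.
by move: xy; rewrite ballEmdist /= mdist_itvE; lra.
Qed.

Lemma flip_tent_map_transitive : topologically_transitive flip_tent_map.
Proof.
apply/transitive_itvP => x y e e0.
have [i [w [i0 w1 xw wy]]] :=
  iter_flip_tent_onto (itv_bounds x) (itv_bounds y) e0.
exists i, (clamp _ w); split; rewrite // mdist_itvE ?iter_flip_tent_map clampE//.
by rewrite wy subrr normr0.
Qed.

Lemma flip_tent_map_odd_period x n :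
  has_least_period flip_tent_map x n -> odd n -> n = 1%N.
Proof.
case=> n0 xn xmin n_odd; apply/eqP; case: (ltngtP n 1) => // [|n1].
  by move: n0; case: n {xn xmin n_odd}.
have x0 : set_val x = 0.
  have xE : iter n flip_tent (set_val x) = set_val x.
    by rewrite -iter_flip_tent_map xn.
  have := itv_bounds x; have [xpos|xneg] := leP 0 (set_val x) => x1.
    have x01 : 0 <= set_val x <= 1 by lra.
    by have := iter_flip_tent_sign n x01; rewrite n_odd xE; lra.
  (* A negative point moves to its opposite, and the remaining even number of steps keeps it in
     [[0, 1]]. *)
  have nx01 : 0 <= - set_val x <= 1 by lra.
  have := iter_flip_tent_sign n.-1 nx01.
  have : ~~ odd n.-1 by move: n_odd; case: n {xn xmin n1 xE} n0.
  move=> /negbTE ->.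
  by rewrite -(flip_tent_le0 (ltW xneg)) -iterSr prednK// xE; lra.
case: (xmin 1%N) => //; apply: val_inj.
by rewrite [LHS](iter_flip_tent_map 1) [RHS]x0 /= x0 flip_tent_le0// oppr0.
Qed.

Lemma flip_tent_map_induced :
  ~ topologically_transitive (induced_map continuous_flip_tent_map).
Proof.
move=> tr; have half_ge0 : 0 <= 2^-1 :> R by lra.
pose w (i : nat) : {nonneg R} := NngNum half_ge0.
have w1 : \sum_(i < 2) (w i)%:num = 1.
  by rewrite !big_ord_recl big_ord0 /=; lra.
pose one := clamp neg1_le1 1; pose none := clamp neg1_le1 (-1).
have oneE : set_val one = 1 by rewrite clampE//; lra.
have noneE : set_val none = -1 by rewrite clampE//; lra.
pose half : borel_probability I := mixture
  (fun i => if i == 0%N then dirac_prob one else dirac_prob none) w1.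
have halfE S : half S =
    (2^-1%:E * dirac_prob one S + 2^-1%:E * dirac_prob none S)%E.
  by rewrite /half mixtureE !big_ord_recl big_ord0 adde0.
have e0 : 0 < 8^-1 :> R by lra.
have [U [oU Uone Ue]] := prohorov_open_nbhs (dirac_prob one) e0.
have [V [oV Vhalf Ve]] := prohorov_open_nbhs half e0.
have [n n1 [_ [[mu /Ue mu_one <-] /Ve mu_half]]] :=
  tr U V oU oV (ex_intro _ _ Uone) (ex_intro _ _ Vhalf).
have muA := dirac_prob_enlarge mu_one.
pose A y : set I := enlarge [set y] 8^-1.
have mA y : measurable (A y : set (borel I)) by exact: measurable_enlarge.
(* Within radius 1/8, [mu] has mass at least 7/8 near [one], and its image at least 1/2 - 1/8 = 3/8
   near [y]. These exceed 1 together, so some point near [one] is sent near [y]. Taking both values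
   of [y] at the same time [n] contradicts parity. *)
have Af y : y = one \/ y = none ->
    exists x, A one x /\ A y (iter n flip_tent_map x).
  move=> y1; pose B := iter n flip_tent_map @^-1` A y : set (borel I).
  have mB : measurable (B : set (borel I)).
    exact (measurable_preimage_iter n continuous_flip_tent_map (mA y)).
  have : (2^-1%:E <= mu B + 8^-1%:E)%E.
    have := prohorov_lt_enlarge (B := [set y]) (c := 2^-1%:E) mu_half.
    rewrite induced_map_iterE; apply => r r0.
    have Ay : dirac_prob y (enlarge [set y] r) = 1%E.
      by rewrite dirac_probE mem_set//; exact: sub_enlarge.
    rewrite halfE; case: y1 => yE; rewrite -yE Ay mule1.
      by rewrite leeDl// mule_ge0.
    by rewrite leeDr// mule_ge0.
  have [p pE] := probability_real mu (mA one).
  have [q qE] := probability_real mu mB.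
  move: muA; rewrite -/(A one) pE qE -!EFinD !lee_fin => h1 h2.
  have [|x [Ax Bx]] := probability_overlap (P := mu) (mA one) mB; last first.
    by exists x.
  by rewrite pE qE -EFinD lte_fin; lra.
have near x y : A y x -> `|set_val x - set_val y| < 8^-1.
  by case/enlargeP => _ ->.
have [x [/near x1 /near fx1]] := Af one (or_introl erefl).
have [y [/near y1 /near fy1]] := Af none (or_intror erefl).
have x01 : 0 <= set_val x <= 1.
  by have := itv_bounds x; move: x1; rewrite oneE ltr_norml; lra.
have y01 : 0 <= set_val y <= 1.
  by have := itv_bounds y; move: y1; rewrite oneE ltr_norml; lra.
have := iter_flip_tent_sign n x01; have := iter_flip_tent_sign n y01.
move: x1 fx1 y1 fy1; rewrite !iter_flip_tent_map oneE noneE !ltr_norml.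
by case: odd; lra.
Qed.

End square_root_of_tent.

Theorem theorem2p3 (R : realType) :
  (forall (a b : R) (ab : a <= b)
      (f : compact_itv ab -> compact_itv ab) (cf : continuous f),
    (exists (x : compact_itv ab) (n : nat),
        [/\ has_least_period f x n, odd n & n <> 1%N]) ->
    (topologically_transitive f <-> topologically_transitive (induced_map cf)))
  /\
  (exists (a b : R) (ab : a <= b)
      (f : compact_itv ab -> compact_itv ab) (cf : continuous f),
    [/\ ~ (exists (x : compact_itv ab) (n : nat),
            [/\ has_least_period f x n, odd n & n <> 1%N]),
        topologically_transitive f
      & ~ topologically_transitive (induced_map cf)]).
Proof.
split=> [a b ab f cf [x [n [xn n_odd n1]]]|].
  split; last exact: induced_transitive_transitive.
  move=> tr; apply: mixing_induced_transitive; first exact: compact_itv_compact.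
  exact: transitive_itv_odd_mixing cf tr xn n_odd n1.
exists (-1), 1, (neg1_le1 R), (@flip_tent_map R), (@continuous_flip_tent_map R).
split.
- by case=> x [n [xn n_odd]]; apply; exact: flip_tent_map_odd_period xn _.
- exact: flip_tent_map_transitive.
- exact: flip_tent_map_induced.
Qed.
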